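(* Let $n \ge 1$ be an integer. There exists a balanced Steinhaus triangle of side length $n$ in $\mathbb{Z}/4\mathbb{Z}$ if and only if $\binom{n+1}{2} \equiv 0 \pmod 4$ (equivalently, $n \equiv 0$ or $7 \pmod 8$). More precisely, consider the following infinite, eventually periodic sequences in $\mathbb{Z}/4\mathbb{Z}$: $$ \begin{array}{l} S_1 = 01220232(212113220030232311200232)^{\infty},\\ S_2 = 21210130(200132022112002110220130)^{\infty},\\ T_1 = 0120021(212202102023032200322021)^{\infty},\\ T_2 = 1000212(312223301210312003103232)^{\infty},\\ T_3 = 1200210(220101222032222103000210)^{\infty},\\ T_4 = 2102203(232002102021230022302203)^{\infty}. \end{array} $$ Then, for all integers $i,j,k$ with $1 \le i \le 2$, $1 \le j \le 4$ and $k \ge 0$, the Steinhaus triangles $\nabla S_i[8k]$ and $\nabla T_j[8k+7]$ are strongly balanced.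
   Context: For a finite sequence $S=(x_{1,1},\dots,x_{1,n})$ in $\mathbb{Z}/m\mathbb{Z}$, the Steinhaus triangle $\nabla S$ is the triangular array $(x_{i,j})_{1\le i\le n,\,1\le j\le n+1-i}$ defined by Pascal's rule $x_{i+1,j}=x_{i,j}+x_{i,j+1}$ (mod $m$); it has side length $n$ and $\binom{n+1}{2}$ entries. It is called balanced if every element of $\mathbb{Z}/m\mathbb{Z}$ occurs in it with the same multiplicity. For a finite or infinite sequence $S=(x_i)_{i\ge1}$ and an integer $0\le l\le$ length of $S$, $S[l]=(x_1,\dots,x_l)$ denotes its initial segment of length $l$. A Steinhaus triangle $\nabla S$ in $\mathbb{Z}/4\mathbb{Z}$ with $S$ of length $n$ is strongly balanced if $\nabla S[n-8t]$ is balanced for every integer $0 \le t \le n/8$ (the empty triangle counts as balanced). In the sequences listed, digits are elements of $\mathbb{Z}/4\mathbb{Z}$ and $(W)^\infty$ denotes infinite repetition of the word $W$ after the initial word. *)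

(* Defs.v *)
From HB Require Import structures.
From mathcomp Require Import all_boot all_order all_algebra.

Set Implicit Arguments.
Unset Strict Implicit.
Unset Printing Implicit Defensive.

Import GRing.Theory.
Local Open Scope ring_scope.

(* 'Z_m is Z/mZ only for 1 < m. *)
Definition pascal_row (m : nat) (s : seq 'Z_m) : seq 'Z_m :=
  mkseq (fun j => s`_j + s`_j.+1) (size s).-1.

(* The rows of the triangle, from top to bottom, the i-th one (from 0) having
   length size s - i. *)
Definition steinhaus (m : nat) (s : seq 'Z_m) : seq (seq 'Z_m) :=
  mkseq (fun i => iter i (@pascal_row m) s) (size s).

Definition multiplicity (m : nat) (s : seq 'Z_m) (a : 'Z_m) : nat :=
  count_mem a (flatten (steinhaus s)).

(* [balanced s] says that the triangle generated by s is balanced. *)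
Definition balanced (m : nat) (s : seq 'Z_m) : Prop :=
  forall a b : 'Z_m, multiplicity s a = multiplicity s b.

Definition strongly_balanced (s : seq 'Z_4) : Prop :=
  forall t : nat, (8 * t <= size s)%N ->
    balanced (take (size s - 8 * t)%N s).

(* Infinite sequences are indexed from 0, so that their initial segment of
   length l is [mkseq x l]. *)
Definition eventually_periodic (T : nmodType) (u w : seq T) (i : nat) : T :=
  if (i < size u)%N then u`_i else w`_((i - size u) %% size w)%N.

Definition S1 : nat -> 'Z_4 := eventually_periodic
  [:: 0; 1; 2; 2; 0; 2; 3; 2]
  [:: 2; 1; 2; 1; 1; 3; 2; 2; 0; 0; 3; 0; 2; 3; 2; 3; 1; 1; 2; 0; 0; 2; 3; 2].
Definition S2 : nat -> 'Z_4 := eventually_periodic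
  [:: 2; 1; 2; 1; 0; 1; 3; 0]
  [:: 2; 0; 0; 1; 3; 2; 0; 2; 2; 1; 1; 2; 0; 0; 2; 1; 1; 0; 2; 2; 0; 1; 3; 0].
Definition T1 : nat -> 'Z_4 := eventually_periodic
  [:: 0; 1; 2; 0; 0; 2; 1]
  [:: 2; 1; 2; 2; 0; 2; 1; 0; 2; 0; 2; 3; 0; 3; 2; 2; 0; 0; 3; 2; 2; 0; 2; 1].
Definition T2 : nat -> 'Z_4 := eventually_periodic
  [:: 1; 0; 0; 0; 2; 1; 2]
  [:: 3; 1; 2; 2; 2; 3; 3; 0; 1; 2; 1; 0; 3; 1; 2; 0; 0; 3; 1; 0; 3; 2; 3; 2].
Definition T3 : nat -> 'Z_4 := eventually_periodic
  [:: 1; 2; 0; 0; 2; 1; 0]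
  [:: 2; 2; 0; 1; 0; 1; 2; 2; 2; 0; 3; 2; 2; 2; 2; 1; 0; 3; 0; 0; 0; 2; 1; 0].
Definition T4 : nat -> 'Z_4 := eventually_periodic
  [:: 2; 1; 0; 2; 2; 0; 3]
  [:: 2; 3; 2; 0; 0; 2; 1; 0; 2; 0; 2; 1; 2; 3; 0; 0; 2; 2; 3; 0; 2; 2; 0; 3].

(* The families are indexed from 0: [S_ i] is S(i+1) and [T_ j] is T(j+1). *)
Definition S_ (i : 'I_2) : nat -> 'Z_4 := tnth [tuple S1; S2] i.
Definition T_ (j : 'I_4) : nat -> 'Z_4 := tnth [tuple T1; T2; T3; T4] j.

(* Main.v *)
Require Import Defs.
From mathcomp Require Import all_boot all_order all_algebra.
From mathcomp Require Import zify.

(** Extend a triangle to the infinite array [X i j] whose row [i] is the [i]-th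
  Pascal derivative of the infinite sequence.  Rows are periodic of period 24
  past column 8, and row 30 equals row 6, so [X] is also periodic of period 24
  downwards.  Hence the number of occurrences of a given element in the
  triangle of side [n] has, for the step 24 in [n], a constant second
  difference once [n >= 14]; its third difference vanishes, and balancedness
  for all [n] in a class mod 8 follows from that for [n < 88], which is
  computed.  Conversely, the [binomial (n + 1) 2] entries of a balanced triangle
  split into 4 classes of the same size. *)

Set Implicit Arguments.
Unset Strict Implicit.
Unset Printing Implicit Defensive.

Import GRing.Theory.

(** * Rows as iterated derivatives of an infinite sequence *)

Definition derived (m : nat) (x : nat -> 'Z_m) (j : nat) : 'Z_m :=
  (x j + x j.+1)%R.

Lemma pascal_row_mkseq (m : nat) (x : nat -> 'Z_m) (n : nat) :
  pascal_row (mkseq x n) = mkseq (derived x) n.-1.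
Proof.
rewrite /pascal_row size_mkseq; apply/eq_in_map => j; rewrite mem_iota => ltjn.
by rewrite !nth_mkseq //; lia.
Qed.

Lemma iter_pascal_row_mkseq (m : nat) (x : nat -> 'Z_m) (n i : nat) :
  iter i (@pascal_row m) (mkseq x n) = mkseq (iter i (@derived m) x) (n - i).
Proof.
elim: i => [|i IHi]; first by rewrite subn0.
by rewrite !iterS IHi pascal_row_mkseq subnS.
Qed.

Lemma multiplicity_mkseq (m : nat) (x : nat -> 'Z_m) (n : nat) (a : 'Z_m) :
  multiplicity (mkseq x n) a =
  \sum_(0 <= i < n) count_mem a (mkseq (iter i (@derived m) x) (n - i)).
Proof.
rewrite /multiplicity /steinhaus size_mkseq count_flatten sumnE !big_map.
by rewrite /index_iota subn0; apply: eq_bigr => i _; rewrite iter_pascal_row_mkseq.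
Qed.

(** * Third differences of triangle sums *)

Section TriangleSums.

Variables (r : nat -> nat -> nat) (I J p : nat).

(* [r i l] counts the occurrences of an element among the first [l] entries of
   row [i]; the first hypothesis is the [p]-periodicity of the row after the
   column [J]. *)
Hypothesis r_col : forall i l, J <= l -> r i (l + p) + r i J = r i (J + p) + r i l.
Hypothesis r_row : forall i l, I <= i -> r (i + p) l = r i l.

Let M n := \sum_(0 <= i < n) r i (n - i).
Let A n := \sum_(I <= i < I + p) r i (n + p - i).

(** In the triangle of side [n + p], the rows below the band counted by [A n] repeat those of the
    triangle of side [n] from row [I] on, and each of the first [I] rows has gained one period. The
    count over a period is [r i (J + p)] minus [r i J], with the subtraction moved across. *)
Lemma triangle_sum_step n : I + J <= n ->
  M (n + p) + \sum_(0 <= i < I) r i J = M n + A n + \sum_(0 <= i < I) r i (J + p).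
Proof.
move=> leIJn; rewrite /M /A (@big_cat_nat _ _ _ I) //=; last by lia.
rewrite (@big_cat_nat _ _ _ (I + p) I) /=; [|lia..].
rewrite [in RHS](@big_cat_nat _ _ _ I) //=; last by lia.
have -> : \sum_(I + p <= i < n + p) r i (n + p - i) =
          \sum_(I <= i < n) r i (n - i).
  rewrite big_addn addnK big_nat_cond [RHS]big_nat_cond.
  by apply: eq_bigr => i /andP[/andP[leIi _] _]; rewrite r_row // subnDr.
suff: \sum_(0 <= i < I) r i (n + p - i) + \sum_(0 <= i < I) r i J =
      \sum_(0 <= i < I) r i (n - i) + \sum_(0 <= i < I) r i (J + p) by lia.
rewrite -!big_split !big_nat; apply: eq_bigr => i /andP[_ ltiI] /=.
have -> : n + p - i = n - i + p by lia.
by rewrite r_col; lia.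
Qed.

Lemma triangle_band_step n : I + J <= n ->
  A (n + p) + \sum_(I <= i < I + p) r i J =
  A n + \sum_(I <= i < I + p) r i (J + p).
Proof.
move=> leIJn; rewrite /A -!big_split !big_nat; apply: eq_bigr => i /= ltiI.
have -> : n + p + p - i = n + p - i + p by lia.
by rewrite r_col; lia.
Qed.

(** The first difference of [M] is [A] up to a constant, and that of [A] is constant. *)
Lemma triangle_sum_diff3 n : I + J <= n ->
  M (n + p + p + p) + 3 * M (n + p) = 3 * M (n + p + p) + M n.
Proof.
move=> leIJn.
have le1 : I + J <= n + p by lia.
have le2 : I + J <= n + p + p by lia.
have := triangle_sum_step leIJn; have := triangle_sum_step le1.
have := triangle_sum_step le2; have := triangle_band_step leIJn.
by have := triangle_band_step le1; lia.
Qed.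

End TriangleSums.

(** * Periodicity of the array *)

Lemma iter_derived_periodic (m : nat) (x : nat -> 'Z_m) (J p i j : nat) :
    (forall k, J <= k -> x (k + p) = x k) -> J <= j ->
  iter i (@derived m) x (j + p) = iter i (@derived m) x j.
Proof.
move=> xP; elim: i j => [|i IHi] j leJj; first exact: xP.
by rewrite iterS /derived -addSn !IHi // ltnW.
Qed.

Lemma eq_iter_derived (m : nat) (x y : nat -> 'Z_m) (i : nat) :
  x =1 y -> iter i (@derived m) x =1 iter i (@derived m) y.
Proof.
by move=> eqxy; elim: i => [|i IHi] j //; rewrite !iterS /derived !IHi.
Qed.

Lemma eq_periodic (T : Type) (x y : nat -> T) (J p : nat) : 0 < p ->
    (forall k, J <= k -> x (k + p) = x k) ->
    (forall k, J <= k -> y (k + p) = y k) ->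
  mkseq x (J + p) = mkseq y (J + p) -> x =1 y.
Proof.
move=> p_gt0 xP yP eqxy; elim/ltn_ind => j IHj.
have [ltj|lej] := ltnP j (J + p).
  by rewrite -(nth_mkseq (x j) x ltj) eqxy nth_mkseq.
have -> : j = j - p + p by lia.
by rewrite xP ?yP ?IHj //; lia.
Qed.

Lemma count_mkseq_periodic (T : eqType) (x : nat -> T) (a : T) (J p l : nat) :
    (forall k, J <= k -> x (k + p) = x k) -> J <= l ->
  count_mem a (mkseq x (l + p)) + count_mem a (mkseq x J) =
  count_mem a (mkseq x (J + p)) + count_mem a (mkseq x l).
Proof.
move=> xP leJl; rewrite -(subnKC leJl); elim: (l - J) => [|d IHd].
  by rewrite addn0.
rewrite addnS addSn !mkseqS -!cats1 !count_cat /= xP ?leq_addr //.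
by lia.
Qed.

Lemma multiplicity_diff3 (m : nat) (x : nat -> 'Z_m) (I J p n : nat) (a : 'Z_m) :
    0 < p -> (forall k, J <= k -> x (k + p) = x k) ->
    mkseq (iter (I + p) (@derived m) x) (J + p) =
    mkseq (iter I (@derived m) x) (J + p) ->
    I + J <= n ->
  multiplicity (mkseq x (n + p + p + p)) a +
    3 * multiplicity (mkseq x (n + p)) a =
  3 * multiplicity (mkseq x (n + p + p)) a + multiplicity (mkseq x n) a.
Proof.
move=> p_gt0 xP rowP leIJn; rewrite !multiplicity_mkseq.
apply: (triangle_sum_diff3
  (r := fun i l => count_mem a (mkseq (iter i (@derived m) x) l)) _ _ leIJn).
- by move=> i l; apply: count_mkseq_periodic => k; apply: iter_derived_periodic.
move=> i l leIi; congr (count_mem _ _); apply: eq_mkseq => j.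
(* Rows [I + p] and [I] agree everywhere by periodicity; deriving both [i - I] more times gives rows
   [i + p] and [i]. *)
have -> : i + p = (i - I) + (I + p) by lia.
have {2}-> : i = (i - I) + I by lia.
rewrite !iterD; apply: eq_iter_derived.
rewrite -iterD; apply: (eq_periodic p_gt0) rowP => k;
  exact: iter_derived_periodic.
Qed.

(* [pascal_row], made linear in the size of the row for computation. *)
Definition pascal_pairmap (m : nat) (s : seq 'Z_m) : seq 'Z_m :=
  if s is x :: s' then pairmap +%R%R x s' else [::].

Lemma pascal_rowE (m : nat) : @pascal_row m =1 @pascal_pairmap m.
Proof.
case=> [|x s] //=; apply: (@eq_from_nth _ 0%R).
  by rewrite size_mkseq size_pairmap.
move=> i; rewrite size_mkseq /= => ltis.
by rewrite nth_mkseq // (nth_pairmap 0%R).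
Qed.

Lemma multiplicityE (m : nat) (s : seq 'Z_m) (a : 'Z_m) :
  multiplicity s a =
  count_mem a (flatten (traject (@pascal_pairmap m) s (size s))).
Proof.
congr (count_mem _ (flatten _)); apply: (@eq_from_nth _ s).
  by rewrite size_mkseq size_traject.
move=> i; rewrite size_mkseq => lti; rewrite nth_mkseq // nth_traject //.
by apply: eq_iter; apply: pascal_rowE.
Qed.

Definition balancedb (s : seq 'Z_4) : bool :=
  let t := flatten (traject (@pascal_pairmap 4) s (size s)) in
  let c := count_mem (0%R : 'Z_4) t in
  [&& count_mem (1%R : 'Z_4) t == c, count_mem (2%R : 'Z_4) t == c
    & count_mem (3%R : 'Z_4) t == c].

Lemma balancedbP (s : seq 'Z_4) : balancedb s -> balanced s.
Proof.
case/and3P => /eqP c1 /eqP c2 /eqP c3.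
suff c0 a : multiplicity s a = multiplicity s 0%R by move=> a b; rewrite !c0.
rewrite !multiplicityE; case: a => [[|[|[|[|//]]]] lta];
  [| rewrite -c1 | rewrite -c2 | rewrite -c3]; by congr (count_mem _ _); apply: val_inj.
Qed.

(* 62 entries of the sequence leave 32 in row 30, which are enough for the
   prefix and one period; 8 * 11 + c >= 6 + J + 3 * 24 makes 11 initial triangles
   sufficient. *)
Definition balanced_check (x : nat -> 'Z_4) (c J : nat) : bool :=
  (take (J + 24) (iter 30 (@pascal_pairmap 4) (mkseq x 62)) ==
   take (J + 24) (iter 6 (@pascal_pairmap 4) (mkseq x 62))) &&
  all (fun k => balancedb (mkseq x (8 * k + c))) (iota 0 11).

Lemma take_mkseq (T : Type) (x : nat -> T) (n l : nat) :
  l <= n -> take l (mkseq x n) = mkseq x l.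
Proof. by move=> leln; rewrite -map_take take_iota (minn_idPl leln). Qed.

Lemma balanced_mkseq (x : nat -> 'Z_4) (c J : nat) :
    J <= 8 -> (forall k, J <= k -> x (k + 24) = x k) -> balanced_check x c J ->
  forall k, balanced (mkseq x (8 * k + c)).
Proof.
move=> leJ8 xP /andP[/eqP rowP /allP base].
have {}rowP : mkseq (iter (6 + 24) (@derived 4) x) (J + 24) =
              mkseq (iter 6 (@derived 4) x) (J + 24).
  move: rowP; rewrite -!(eq_iter (@pascal_rowE 4)) !iter_pascal_row_mkseq.
  by rewrite !take_mkseq //; lia.
elim/ltn_ind => k IHk; have [ltk|lek] := ltnP k 11.
  by apply/balancedbP/base; rewrite mem_iota.
(* Three periods of 24 lower [k] by 9; as [k >= 11] and [J <= 8], the smallest side is still at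
   least 16, hence at least [6 + J]. *)
move=> a b; pose n := 8 * (k - 9) + c.
have -> : 8 * k + c = n + 24 + 24 + 24 by rewrite /n; lia.
have leIJn : 6 + J <= n by rewrite /n; lia.
have := multiplicity_diff3 a (isT : 0 < 24) xP rowP leIJn.
have := multiplicity_diff3 b (isT : 0 < 24) xP rowP leIJn.
have -> : n + 24 + 24 = 8 * (k - 3) + c by rewrite /n; lia.
have -> : n + 24 = 8 * (k - 6) + c by rewrite /n; lia.
have := IHk (k - 3) ltac:(lia) a b; have := IHk (k - 6) ltac:(lia) a b.
have : multiplicity (mkseq x n) a = multiplicity (mkseq x n) b.
  by apply: IHk; lia.
by lia.
Qed.

(** * The six sequences *)

Lemma eventually_periodicD (T : nmodType) (u w : seq T) (k : nat) :
  size u <= k -> eventually_periodic u w (k + size w) = eventually_periodic u w k.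
Proof.
move=> lek; rewrite /eventually_periodic !ltnNge lek (leq_trans lek) ?leq_addr //=.
by rewrite addnC -addnBA // modnDl.
Qed.

Lemma balanced_S (i : 'I_2) (k : nat) : balanced (mkseq (S_ i) (8 * k)).
Proof.
rewrite -[8 * k]addn0; apply: (@balanced_mkseq _ _ 8) => //.
- by case: i => [[|[|//]] lti] l lel; rewrite /S_ (tnth_nth S1) /=;
    apply: eventually_periodicD.
by case: i => [[|[|//]] lti]; vm_compute.
Qed.

Lemma balanced_T (j : 'I_4) (k : nat) : balanced (mkseq (T_ j) (8 * k + 7)).
Proof.
apply: (@balanced_mkseq _ _ 7) => //.
- by case: j => [[|[|[|[|//]]]] ltj] l lel; rewrite /T_ (tnth_nth T1) /=;
    apply: eventually_periodicD.
by case: j => [[|[|[|[|//]]]] ltj]; vm_compute.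
Qed.

(** * Necessity of the congruence *)

Lemma size_flatten_steinhaus (m : nat) (s : seq 'Z_m) :
  size (flatten (steinhaus s)) = 'C((size s).+1, 2).
Proof.
rewrite size_flatten /shape -map_comp sumnE big_map -(subn0 (size s)).
rewrite -[iota _ _]/(index_iota 0 (size s)) -bin2_sum subn0.
(* Dropping the term 0 of [bin2_sum] and listing the rows from the bottom up makes the sizes match
   term by term. *)
rewrite big_nat_recl // add0n big_nat_rev /= add0n !big_nat.
apply: eq_bigr => i /= lti.
rewrite -[s in iter _ _ s](mkseq_nth 0%R) iter_pascal_row_mkseq !size_mkseq.
exact: subKn.
Qed.

Lemma balanced_dvd (s : seq 'Z_4) : balanced s -> 4 %| 'C((size s).+1, 2).
Proof.
move=> bal_s; rewrite -size_flatten_steinhaus -sum1_size.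
rewrite (partition_big id xpredT) //=.
rewrite (eq_bigr (fun=> multiplicity s 0%R)) => [|a _].
  by rewrite sum_nat_const card_ord dvdn_mulr.
by rewrite sum1_count; apply: bal_s.
Qed.

(** Twice the binomial is [n * (n + 1)], so the condition is that 8 divides this product of coprime
    factors. With a literal remainder of [n] modulo 8, the square of the quotient is the only
    nonlinear term left for [lia]. *)
Lemma bin2_mod4 (n : nat) :
  'C(n.+1, 2) = 0 %[mod 4] <-> n = 0 %[mod 8] \/ n = 7 %[mod 8].
Proof.
have := mul_bin_diag n.+1 1; rewrite bin1 /=; move: 'C(n.+1, 2) => c.
have [q [r ltr8 ->]] : exists q, exists2 r, r < 8 & n = q * 8 + r.
  by exists (n %/ 8), (n %% 8); [rewrite ltn_pmod | apply: divn_eq].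
case: r ltr8 => [|[|[|[|[|[|[|[|//]]]]]]]] _; rewrite !modnMDl => cE.
all: by split; lia.
Qed.

Theorem theorem1 :
  (forall n : nat, 1 <= n ->
     ((exists s : n.-tuple 'Z_4, balanced s) <-> 'C(n.+1, 2) = 0 %[mod 4]) /\
     ('C(n.+1, 2) = 0 %[mod 4] <-> (n = 0 %[mod 8] \/ n = 7 %[mod 8]))) /\
  (forall (i : 'I_2) (j : 'I_4) (k : nat),
     strongly_balanced (mkseq (S_ i) (8 * k)) /\
     strongly_balanced (mkseq (T_ j) (8 * k + 7))).
Proof.
split=> [n _ | i j k].
  split; last exact: bin2_mod4.
  split=> [[s /balanced_dvd] | /bin2_mod4 n_mod8].
    by rewrite size_tuple => /eqP.
  suff [x bal_x] : exists x : nat -> 'Z_4, balanced (mkseq x n).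
    by exists (tcast (size_mkseq x n) (in_tuple (mkseq x n))); rewrite val_tcast.
  case: n_mod8 => n_mod8.
    exists S1; have -> : n = 8 * (n %/ 8) by lia.
    exact: (balanced_S ord0).
  exists T1; have -> : n = 8 * (n %/ 8) + 7 by lia.
  exact: (balanced_T ord0).
(* Removing [8 * t] terms leaves an initial segment of the same family, so balance for every [k]
   already gives strong balance. *)
split=> t; rewrite size_mkseq => let8; rewrite take_mkseq ?leq_subr //.
  by rewrite -mulnBr; apply: balanced_S.
have -> : 8 * k + 7 - 8 * t = 8 * (k - t) + 7 by lia.
exact: balanced_T.
Qed.
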